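(* Let $I$ be an instance of SPA-ST and let $J$ be the integer program for $I$ described in the context. If $S$ is a feasible solution to $J$, then $M=\{(s_i,p_j): x_{i,j}=1 \text{ in } S\}$ is a super-stable matching in $I$ with $|M|$ equal to the objective value of $S$. Conversely, if $M$ is a super-stable matching in $I$, then there is a feasible solution $S$ to $J$ with $x_{i,j}=1$ exactly for $(s_i,p_j)\in M$, whose objective value equals $|M|$.
   Context: An instance $I$ of SPA-ST consists of students $s_1,\dots,s_{n_1}$, projects $p_1,\dots,p_{n_2}$ and lecturers $l_1,\dots,l_{n_3}$. Each student $s_i$ has a set $A_i$ of acceptable projects ranked as a strict ranking of ties (a tie is a set of equally preferred entries). Each lecturer $l_k$ offers a non-empty set $P_k$ of projects, the $P_k$ partitioning the projects; $l_k$ has capacity $d_k\in\mathbb{Z}^+$ and a preference list $\mathcal{L}_k$ ranking, as a strict ranking of ties, exactly those students finding some project in $P_k$ acceptable; $\mathcal{L}_k^j$ is $\mathcal{L}_k$ restricted to students finding $p_j$ acceptable. Project $p_j$ has capacity $c_j\in\mathbb{Z}^+$, and $\max\{c_j:p_j\in P_k\}\le d_k\le\sum_{p_j\in P_k}c_j$. A matching is a set $M$ of acceptable pairs with each student in at most one pair, $|M(p_j)|\le c_j$, $|M(l_k)|\le d_k$ ($M(p_j)$: students assigned to $p_j$; $M(l_k)$: students assigned to projects of $P_k$). Undersubscribed/full means fewer than/exactly capacity many assignees. With $l_k$ the lecturer offering $p_j$, $M$ is super-stable if no acceptable pair $(s_i,p_j)\notin M$ satisfies: (a) $s_i$ is unassigned,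 or prefers $p_j$ to $M(s_i)$ or is indifferent between them, and (b) either (i) $p_j$ and $l_k$ are undersubscribed, or (ii) $p_j$ is undersubscribed, $l_k$ is full and either $s_i\in M(l_k)$ or $l_k$ prefers $s_i$ to a worst student in $M(l_k)$ or is indifferent between them, or (iii) $p_j$ is full and $l_k$ prefers $s_i$ to a worst student in $M(p_j)$ or is indifferent between them. Ranks: $\mathrm{rank}(s_i,p_j)=1+$ the number of projects $s_i$ strictly prefers to $p_j$; $\mathrm{rank}(l_k,s_i)=1+$ the number of students $l_k$ strictly prefers to $s_i$. For acceptable $(s_i,p_j)$ with $p_j\in P_k$: $S_{i,j}=\{p_{j'}\in A_i:\mathrm{rank}(s_i,p_{j'})<\mathrm{rank}(s_i,p_j)\}$, $T_{i,j,k}=\{s_{i'}\in\mathcal{L}_k^j:\mathrm{rank}(l_k,s_{i'})<\mathrm{rank}(l_k,s_i)\}$, $D_{i,k}=\{s_{i'}\in\mathcal{L}_k:\mathrm{rank}(l_k,s_{i'})<\mathrm{rank}(l_k,s_i)\}$. (Sums $\sum_{i'}x_{i',j}$ range over students for whom $p_j$ is acceptable.) The IP $J$ has binary variables $x_{i,j}$ for each acceptable pair $(s_i,p_j)$, $\alpha_j,\gamma_j$ for each project, $\beta_k,\eta_k$ for each lecturer, and $\delta_{i,k}$, $\lambda_{i,j,k}$ for each acceptable pair $(s_i,p_j)$ with $p_j\in P_k$. Constraints: $\sum_{p_j\in A_i}x_{i,j}\le 1$ for each $i$; $\sum_{i'}x_{i',j}\le c_j$ for each $j$; $\sum_{i'}\sum_{p_{j'}\in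 P_k}x_{i',j'}\le d_k$ for each $k$; and for every acceptable pair $(s_i,p_j)$ with $p_j\in P_k$, writing $\theta_{i,j}=1-x_{i,j}-\sum_{p_{j'}\in S_{i,j}}x_{i,j'}$: $c_j\alpha_j\ge c_j-\sum_{i'}x_{i',j}$; $d_k\beta_k\ge d_k-\sum_{i'}\sum_{p_{j'}\in P_k}x_{i',j'}$; $\theta_{i,j}+\alpha_j+\beta_k\le 2$; $d_k\eta_k\ge\big(1+\sum_{i'}\sum_{p_{j'}\in P_k}x_{i',j'}\big)-d_k$; $d_k\delta_{i,k}\ge\sum_{i'}\sum_{p_{j'}\in P_k}x_{i',j'}-\sum_{s_{i'}\in D_{i,k}}\sum_{p_{j'}\in P_k}x_{i',j'}$; $\theta_{i,j}+\alpha_j+\eta_k+\delta_{i,k}\le 3$; $c_j\gamma_j\ge\big(1+\sum_{i'}x_{i',j}\big)-c_j$; $c_j\lambda_{i,j,k}\ge\sum_{i'}x_{i',j}-\sum_{s_{i'}\in T_{i,j,k}}x_{i',j}$; $\theta_{i,j}+\gamma_j+\lambda_{i,j,k}\le 2$. Objective: maximise $\sum_{i}\sum_{p_j\in A_i}x_{i,j}$. *)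

(* Defs.v *)
From mathcomp Require Import all_boot all_order all_algebra.

Set Implicit Arguments.
Unset Strict Implicit.
Unset Printing Implicit Defensive.

Import Order.TTheory GRing.Theory Num.Theory.

(* A strict ranking of ties: the sets of [ties] are listed from most to least
   preferred, and the elements of one set are equally preferred. *)
Record pref_list (T : finType) := PrefList {
  ties : seq {set T};
  ties_nonempty : set0 \notin ties;
  ties_disjoint : pairwise (fun A B : {set T} => [disjoint A & B]) ties
}.

Section PrefList.
Variables (T : finType) (L : pref_list T).

Definition entries : {set T} := \bigcup_(A <- ties L) A.

Definition tie_index (x : T) : nat := find (fun A : {set T} => x \in A) (ties L).

Definition prefers (x y : T) : bool :=
  [&& x \in entries, y \in entries & tie_index x < tie_index y].

Definition indifferent (x y : T) : bool :=
  [&& x \in entries, y \in entries & tie_index x == tie_index y].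

Definition prefers_or_indifferent (x y : T) : bool :=
  prefers x y || indifferent x y.

Definition rank (x : T) : nat := 1 + #|[set y | prefers y x]|.

Definition worst_in (X : {set T}) (x : T) : bool :=
  (x \in X) && [forall y in X, ~~ prefers x y].

End PrefList.

(* The partition of the projects into the non-empty sets P_k is given by the
   surjection [lecturer] sending a project to the lecturer who offers it. *)
Record spa_st (n1 n2 n3 : nat) := SpaST {
  student_pref : 'I_n1 -> pref_list 'I_n2;
  lecturer_pref : 'I_n3 -> pref_list 'I_n1;
  lecturer : 'I_n2 -> 'I_n3;
  pcap : 'I_n2 -> nat;
  lcap : 'I_n3 -> nat;
  offers_nonempty : forall k : 'I_n3, exists j : 'I_n2, lecturer j = k;
  lecturer_entries : forall k : 'I_n3,
    entries (lecturer_pref k) =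
    [set i | [exists j, (lecturer j == k) && (j \in entries (student_pref i))]];
  pcap_gt0 : forall j : 'I_n2, 0 < pcap j;
  lcap_gt0 : forall k : 'I_n3, 0 < lcap k;
  pcap_le_lcap : forall j : 'I_n2, pcap j <= lcap (lecturer j);
  lcap_le_sum : forall k : 'I_n3, lcap k <= \sum_(j | lecturer j == k) pcap j
}.

Section Instance.
Variables (n1 n2 n3 : nat) (inst : spa_st n1 n2 n3).

Notation student := 'I_n1.
Notation project := 'I_n2.
Notation lect := 'I_n3.

Definition A_ (i : student) : {set project} := entries (student_pref inst i).

Definition acceptable (i : student) (j : project) : bool := j \in A_ i.

Definition P_ (k : lect) : {set project} := [set j | lecturer inst j == k].

Definition L_ (k : lect) : {set student} := entries (lecturer_pref inst k).

Definition Lproj (k : lect) (j : project) : {set student} :=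
  [set i in L_ k | acceptable i j].

Section Matching.
Variable M : {set student * project}.

Definition Mproj (j : project) : {set student} := [set i | (i, j) \in M].

Definition Mlect (k : lect) : {set student} :=
  [set i | [exists j in P_ k, (i, j) \in M]].

Definition unassigned (i : student) : bool := [forall j, (i, j) \notin M].

Definition is_matching : Prop :=
  [/\ forall i j, (i, j) \in M -> acceptable i j,
      forall i j j', (i, j) \in M -> (i, j') \in M -> j = j',
      forall j, #|Mproj j| <= pcap inst j
    & forall k, #|Mlect k| <= lcap inst k].

Definition p_under (j : project) : bool := #|Mproj j| < pcap inst j.
Definition p_full (j : project) : bool := #|Mproj j| == pcap inst j.
Definition l_under (k : lect) : bool := #|Mlect k| < lcap inst k.
Definition l_full (k : lect) : bool := #|Mlect k| == lcap inst k.

Definition student_blocks (i : student) (j : project) : bool :=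
  unassigned i ||
  [exists j', ((i, j') \in M) &&
              prefers_or_indifferent (student_pref inst i) j j'].

Definition beats_worst (k : lect) (i : student) (X : {set student}) : bool :=
  [exists i', worst_in (lecturer_pref inst k) X i' &&
              prefers_or_indifferent (lecturer_pref inst k) i i'].

Definition lecturer_blocks (i : student) (j : project) : bool :=
  let k := lecturer inst j in
  [|| p_under j && l_under k,
      [&& p_under j, l_full k & (i \in Mlect k) || beats_worst k i (Mlect k)]
    | p_full j && beats_worst k i (Mproj j)].

Definition blocking_pair (i : student) (j : project) : bool :=
  [&& acceptable i j, (i, j) \notin M,
      student_blocks i j & lecturer_blocks i j].

Definition super_stable_matching : Prop :=
  is_matching /\ forall i j, ~~ blocking_pair i j.

End Matching.

Definition S_ (i : student) (j : project) : {set project} :=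
  [set j' in A_ i |
     rank (student_pref inst i) j' < rank (student_pref inst i) j].

Definition T_ (i : student) (j : project) (k : lect) : {set student} :=
  [set i' in Lproj k j |
     rank (lecturer_pref inst k) i' < rank (lecturer_pref inst k) i].

Definition D_ (i : student) (k : lect) : {set student} :=
  [set i' in L_ k |
     rank (lecturer_pref inst k) i' < rank (lecturer_pref inst k) i].

Definition acc_pair := {p : student * project | acceptable p.1 p.2}.

Definition stud (q : acc_pair) : student := (val q).1.
Definition proj (q : acc_pair) : project := (val q).2.
Definition plect (q : acc_pair) : lect := lecturer inst (proj q).

Definition list_pair := {p : student * lect |
  [exists j, acceptable p.1 j && (j \in P_ p.2)]}.

Lemma acc_list_subproof (q : acc_pair) :
  [exists j, acceptable (stud q, plect q).1 j && (j \in P_ (stud q, plect q).2)].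
Proof. by apply/existsP; exists (proj q); rewrite inE eqxx andbT (valP q). Qed.

Definition acc_list (q : acc_pair) : list_pair :=
  exist _ (stud q, plect q) (acc_list_subproof q).

(* The binary variables are booleans, read as 0 and 1 in int.  The lecturer
   index k of lambda_{i,j,k} is determined by j. *)
Record solution := Solution {
  xv : acc_pair -> bool;
  alpha : project -> bool;
  beta : lect -> bool;
  gamma : project -> bool;
  eta : lect -> bool;
  delta : list_pair -> bool;
  lambda : acc_pair -> bool
}.

Local Open Scope ring_scope.

Section Feasible.
Variable s : solution.

Definition sum_stud (i : student) : int := \sum_(q | stud q == i) (xv s q)%:Z.

Definition sum_proj (j : project) : int := \sum_(q | proj q == j) (xv s q)%:Z.

Definition sum_lect (k : lect) : int :=
  \sum_(q | proj q \in P_ k) (xv s q)%:Z.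

Definition sum_S (i : student) (j : project) : int :=
  \sum_(q | (stud q == i) && (proj q \in S_ i j)) (xv s q)%:Z.

Definition sum_D (i : student) (k : lect) : int :=
  \sum_(q | (stud q \in D_ i k) && (proj q \in P_ k)) (xv s q)%:Z.

Definition sum_T (i : student) (j : project) (k : lect) : int :=
  \sum_(q | (stud q \in T_ i j k) && (proj q == j)) (xv s q)%:Z.

Definition theta (q : acc_pair) : int :=
  1 - (xv s q)%:Z - sum_S (stud q) (proj q).

Definition pair_constraints (q : acc_pair) : Prop :=
  let i := stud q in
  let j := proj q in
  let k := plect q in
  let c := (pcap inst j)%:Z in
  let d := (lcap inst k)%:Z in
  let a := (alpha s j)%:Z in
  let b := (beta s k)%:Z in
  let g := (gamma s j)%:Z in
  let e := (eta s k)%:Z in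
  let dl := (delta s (acc_list q))%:Z in
  let la := (lambda s q)%:Z in
  (c * a >= c - sum_proj j) /\
  (d * b >= d - sum_lect k) /\
  (theta q + a + b <= 2) /\
  (d * e >= (1 + sum_lect k) - d) /\
  (d * dl >= sum_lect k - sum_D i k) /\
  (theta q + a + e + dl <= 3) /\
  (c * g >= (1 + sum_proj j) - c) /\
  (c * la >= sum_proj j - sum_T i j k) /\
  (theta q + g + la <= 2).

Definition feasible : Prop :=
  [/\ forall i, sum_stud i <= 1,
      forall j, sum_proj j <= (pcap inst j)%:Z,
      forall k, sum_lect k <= (lcap inst k)%:Z
    & forall q, pair_constraints q].

Definition objective : int := \sum_i sum_stud i.

Definition matching_of : {set student * project} := [set val q | q in xv s].

End Feasible.

End Instance.

(* Main.v *)
Require Import Defs.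
From mathcomp Require Import all_boot all_order all_algebra.
From mathcomp Require Import zify.

(** Identify the variables [x] with the set [M] of pairs they select.  Every sum
    in the program then counts a part of [M]: [theta] is the truth value of
    "the student would block", and [sum_lect - sum_D] and [sum_proj - sum_T] are
    positive exactly when some assignee is not strictly better than [s_i], which
    is when [s_i] is an assignee or ties with or beats a worst one.  With this
    dictionary each big-M inequality forces its binary variable to 1 precisely when the
    corresponding clause of the definition of a blocking pair holds, and the
    three inequalities bounding [theta] exclude clauses (i), (ii) and (iii). *)

Set Implicit Arguments.
Unset Strict Implicit.
Unset Printing Implicit Defensive.

Import Order.TTheory GRing.Theory Num.Theory.

(** * Ranks and worst elements of preference lists *)

Lemma rank_ltE (T : finType) (L : pref_list T) (x y : T) :
  x \in entries L -> y \in entries L -> (rank L x < rank L y) = prefers L x y.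
Proof.
move=> xL yL; rewrite /rank ltn_add2l; apply/idP/idP => [|xy].
  apply: contraTT; rewrite /prefers xL yL /= -!leqNgt => le_yx.
  apply/subset_leq_card/subsetP => z; rewrite !inE.
  by case/andP=> -> /= /leq_trans->.
apply/proper_card/properP; split.
  apply/subsetP => z; rewrite !inE /prefers xL yL /= => /andP[-> /= zx].
  by case/and3P: xy => _ _; apply: ltn_trans zx.
by exists x; rewrite !inE //; rewrite /prefers ltnn !andbF.
Qed.

Lemma prefers_or_indifferentE (T : finType) (L : pref_list T) (x y : T) :
  x \in entries L -> y \in entries L ->
  prefers_or_indifferent L x y = ~~ prefers L y x.
Proof.
move=> xL yL; rewrite /prefers_or_indifferent /prefers /indifferent xL yL /=.
by rewrite -leqNgt [RHS]leq_eqVlt orbC.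
Qed.

(** A member of maximal tie index is worst; the bound lets any member be traded for a worst one. *)
Lemma exists_worst (T : finType) (L : pref_list T) (X : {set T}) (x : T) :
  x \in X -> exists2 w, worst_in L X w & tie_index L x <= tie_index L w.
Proof.
move=> xX; case: (@arg_maxnP _ x [in X] (tie_index L) xX) => w wX wmax.
exists w; last exact: wmax.
apply/andP; split=> //; apply/forall_inP => y yX.
by rewrite /prefers !negb_and -leqNgt; do 2![apply/orP; right]; apply: wmax.
Qed.

(** Turns the inclusions in the blocking condition into the cardinalities that the constraints
    compare, ready for [lia]. *)
Lemma subset_cardI (T : finType) (X Y : {set T}) :
  (X \subset Y) = (#|X| <= #|X :&: Y|).
Proof. by rewrite (sameP setIidPl eqP) eqEcard subsetIl. Qed.

(** * Sums of the program as cardinalities of parts of [M] *)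

Section Dictionary.

Variables (n1 n2 n3 : nat) (inst : spa_st n1 n2 n3).

Lemma acceptable_L (i : 'I_n1) (j : 'I_n2) :
  acceptable inst i j -> i \in L_ inst (lecturer inst j).
Proof.
move=> ij; rewrite /L_ lecturer_entries inE; apply/existsP; exists j.
by rewrite eqxx.
Qed.

(** If some member of [X] is not strictly better than [i], neither is a worst member at least as far
    down the list. *)
Lemma beats_worstE (k : 'I_n3) (i : 'I_n1) (X : {set 'I_n1}) :
  i \in L_ inst k -> X \subset L_ inst k ->
  beats_worst inst k i X = ~~ (X \subset D_ inst i k).
Proof.
move=> iL /subsetP XLP; apply/existsP/subsetPn.
  case=> w /andP[/andP[wX _]]; have wL := XLP _ wX.
  rewrite prefers_or_indifferentE // => iw; exists w => //.
  by rewrite inE wL rank_ltE.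
case=> x xX; rewrite inE (XLP _ xX) rank_ltE ?(XLP _ xX) //= => xi.
have [w w_worst xw] := exists_worst (lecturer_pref inst k) xX.
exists w; rewrite w_worst /=.
have wL : w \in L_ inst k by case/andP: w_worst => /XLP.
rewrite prefers_or_indifferentE //; apply: contra xi.
by rewrite /prefers iL wL (XLP _ xX) /=; apply: leq_ltn_trans.
Qed.

(** [s] and [M] are tied only by [xvE], so the dictionary serves both directions of the theorem. *)
Variables (s : solution inst) (M : {set 'I_n1 * 'I_n2}).
Hypothesis xvE : forall q, xv s q = (val q \in M).
Hypothesis M_acc : forall i j, (i, j) \in M -> acceptable inst i j.

Local Open Scope ring_scope.

(** All pairs of [M] are acceptable, so [val] maps the selected indices bijectively onto [M]. *)
Lemma sum_xvE (P : pred ('I_n1 * 'I_n2)) :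
  \sum_(q : acc_pair inst | P (val q)) (xv s q)%:Z
    = #|[set p in M | P p]|%:Z.
Proof.
have -> : [set p in M | P p]
    = [set val q | q in [set q : acc_pair inst | P (val q) & xv s q]].
  apply/setP => -[i j]; rewrite inE; apply/andP/imsetP => [[ijM Pij]|].
    by exists (exist _ (i, j) (M_acc ijM)); rewrite // inE xvE Pij.
  by case=> q; rewrite inE xvE => /andP[Pq qM] ->.
rewrite card_imset; last exact: val_inj.
rewrite -sum1_card (big_morph Posz PoszD (erefl _)).
rewrite [RHS]big_mkcond [LHS]big_mkcond; apply: eq_bigr => q _.
by rewrite inE; case: (P _); case: (xv s q).
Qed.

Lemma sum_studE i : sum_stud s i = #|[set p in M | p.1 == i]|%:Z.
Proof. exact: sum_xvE (fun p => p.1 == i). Qed.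

Lemma objectiveE : objective s = #|M|%:Z.
Proof.
have -> : objective s = \sum_q (xv s q)%:Z.
  by rewrite (partition_big (@stud _ _ _ inst) xpredT).
rewrite (sum_xvE xpredT); congr (Posz #|pred_of_set _|).
by apply/setP => p; rewrite inE andbT.
Qed.

Lemma sum_studP :
  (forall i, sum_stud s i <= 1)
  <-> (forall i j j', (i, j) \in M -> (i, j') \in M -> j = j').
Proof.
split=> [le1 i j j' ij ij'|M_fun i].
  have := le1 i; rewrite sum_studE lez_nat => /card_le1_eqP/(_ (i, j) (i, j')).
  by rewrite !inE ij ij' eqxx => /(_ isT isT)[].
rewrite sum_studE lez_nat; apply/card_le1_eqP => -[i1 j1] [i2 j2].
rewrite !inE /= => /andP[ij1 /eqP e1] /andP[ij2 /eqP e2]; subst i1 i2.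
by rewrite (M_fun _ _ _ ij1 ij2).
Qed.

Lemma card_M_proj (j : 'I_n2) (X : {set 'I_n1}) :
  #|[set p in M | (p.1 \in X) && (p.2 == j)]| = #|Mproj M j :&: X|.
Proof.
have pair_inj : injective (fun i : 'I_n1 => (i, j)) by move=> ? ? [].
rewrite -(card_imset _ pair_inj); apply: eq_card => -[i j'].
rewrite inE /=; apply/and3P/imsetP => [[ij iX /eqP e]|].
  by subst j'; exists i; rewrite // !inE ij.
by case=> i'; rewrite !inE => /andP[ij iX] [-> ->]; rewrite eqxx.
Qed.

Lemma sum_projE j : sum_proj s j = #|Mproj M j|%:Z.
Proof.
rewrite -[Mproj M j]setIT -card_M_proj -sum_xvE.
by apply: eq_bigl => q; rewrite in_setT.
Qed.

Lemma Mproj_sub_L (j : 'I_n2) : Mproj M j \subset L_ inst (lecturer inst j).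
Proof. by apply/subsetP => i; rewrite inE => /M_acc/acceptable_L. Qed.

Lemma Mlect_sub_L (k : 'I_n3) : Mlect inst M k \subset L_ inst k.
Proof.
apply/subsetP => i; rewrite inE => /exists_inP[j].
by rewrite inE => /eqP<- /M_acc/acceptable_L.
Qed.

(** [T_] and [D_] differ only by students who find [j] unacceptable, and none of these is assigned
    to [j]. *)
Lemma sum_TE i j (k := lecturer inst j) :
  sum_T s i j k = #|Mproj M j :&: D_ inst i k|%:Z.
Proof.
have -> : Mproj M j :&: D_ inst i k = Mproj M j :&: T_ inst i j k.
  apply/setP => i'; rewrite !inE; have [/M_acc ij|//] := boolP (_ \in M).
  by rewrite ij andbT.
by rewrite -card_M_proj -sum_xvE; apply: eq_bigl.
Qed.

Hypothesis M_fun : forall i j j', (i, j) \in M -> (i, j') \in M -> j = j'.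

(** Counting pairs is counting students: by [M_fun], [fst] is injective on [M]. *)
Lemma card_M_lect (k : 'I_n3) (X : {set 'I_n1}) :
  #|[set p in M | (p.1 \in X) && (p.2 \in P_ inst k)]|
    = #|Mlect inst M k :&: X|.
Proof.
rewrite -(card_in_imset (f := fst)); last first.
  move=> [i j] [i' j'] /=; rewrite !inE /= => /andP[ij _] /andP[ij' _] e.
  by subst i'; rewrite (M_fun ij ij').
apply: eq_card => i; apply/imsetP/idP => [[[i' j]]|].
  rewrite inE /= => /and3P[ij iX jk] ->; rewrite !inE iX andbT.
  by apply/exists_inP; exists j.
rewrite inE => /andP[]; rewrite inE => /exists_inP[j jk ij] iX.
by exists (i, j); rewrite // inE ij iX jk.
Qed.

Lemma sum_lectE k : sum_lect s k = #|Mlect inst M k|%:Z.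
Proof.
rewrite -[Mlect _ M k]setIT -card_M_lect -sum_xvE.
by apply: eq_bigl => q; rewrite in_setT.
Qed.

Lemma sum_DE i k : sum_D s i k = #|Mlect inst M k :&: D_ inst i k|%:Z.
Proof. by rewrite -card_M_lect -sum_xvE; apply: eq_bigl. Qed.

(** By [M_fun] at most one summand is nonzero, so the sum is a truth value. *)
Lemma sum_SE i j :
  sum_S s i j = [exists j' in S_ inst i j, (i, j') \in M]%:Z.
Proof.
rewrite /sum_S (sum_xvE (fun p => (p.1 == i) && (p.2 \in S_ inst i j))).
have [/exists_inP[j1 j1S ij1]|/exists_inPn noS] :=
  boolP [exists j1 in S_ inst i j, (i, j1) \in M].
  rewrite (_ : [set _ in M | _] = [set (i, j1)]) ?cards1 //.
  apply/setP => -[i2 j2]; rewrite in_set1 xpair_eqE in_set /=.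
  apply/and3P/andP => [[ij2 /eqP e _]|[/eqP-> /eqP->]]; last by split.
  by subst i2; rewrite eqxx (M_fun ij2 ij1).
rewrite (_ : [set _ in M | _] = set0) ?cards0 //.
apply/setP => -[i2 j2]; rewrite in_set0 inE /=.
by apply/and3P => -[ij2 /eqP e /noS]; rewrite -e ij2.
Qed.

(** For a pair in [M], [sum_S] vanishes, since the student's only project is not better than itself.
    Otherwise [theta] is 0 exactly when the student has a strictly better project. *)
Lemma thetaE q :
  theta s q = ((val q \notin M) && student_blocks inst M (stud q) (proj q))%:Z.
Proof.
rewrite /theta xvE sum_SE; set i := stud q; set j := proj q.
have ->: val q = (i, j) by rewrite /i /j /stud /proj; case: (val q).
have jA : acceptable inst i j by exact: valP q.
have [ijM|ijM] := boolP (_ \in M).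
  rewrite (_ : [exists _ in _, _] = false) //.
  apply/negbTE/exists_inPn => j'; rewrite inE => /andP[_ j'j].
  by apply: contraTN j'j => /(M_fun ijM)<-; rewrite ltnn.
suff -> : student_blocks inst M i j =
    ~~ [exists j' in S_ inst i j, (i, j') \in M].
  by case: [exists _ in _, _].
apply/orP/exists_inPn => [|noS].
  case=> [/forallP un j' _|/existsP[j1 /andP[ij1]]]; first exact: un.
  have j1A : j1 \in A_ inst i := M_acc ij1.
  rewrite prefers_or_indifferentE // => j1j j'.
  rewrite inE => /andP[j'A]; apply: contraTN => /(M_fun ij1)<-.
  by rewrite rank_ltE.
have [|/forallPn[j1 /negPn ij1]] := boolP (unassigned M i); first by left.
right; apply/existsP; exists j1; rewrite ij1.
have j1A : j1 \in A_ inst i := M_acc ij1.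
rewrite prefers_or_indifferentE //.
by apply: contraL ij1 => j1j; apply: noS; rewrite inE j1A rank_ltE.
Qed.

Lemma lecturer_blocksE i j (k := lecturer inst j) : acceptable inst i j ->
  lecturer_blocks inst M i j =
  [|| p_under inst M j && l_under inst M k,
      [&& p_under inst M j, l_full inst M k
        & ~~ (Mlect inst M k \subset D_ inst i k)]
    | p_full inst M j && ~~ (Mproj M j \subset D_ inst i k)].
Proof.
move=> ij; rewrite /lecturer_blocks -/k.
rewrite !beats_worstE ?acceptable_L ?Mproj_sub_L ?Mlect_sub_L //.
(* The clause that [i] is already assigned to [k] is absorbed: [i] is never in its own [D_]. *)
have [iM|//] := boolP (i \in Mlect inst M k).
suff -> : ~~ (Mlect inst M k \subset D_ inst i k) by [].
by apply/subsetPn; exists i => //; rewrite inE ltnn andbF.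
Qed.

Lemma pair_constraints_not_blocking q :
  pair_constraints s q -> ~~ blocking_pair inst M (stud q) (proj q).
Proof.
rewrite /pair_constraints /plect sum_projE sum_lectE sum_TE sum_DE thetaE.
rewrite /blocking_pair (valP q) /= lecturer_blocksE ?(valP q) //.
rewrite -surjective_pairing /p_under /p_full /l_under /l_full.
rewrite !subset_cardI.
set k := lecturer inst _; set i := stud q; set j := proj q.
have := pcap_gt0 inst j; have := lcap_gt0 inst k.
case: (_ \notin M); case: (student_blocks _ _ _ _) => //=.
(* Here [theta] is 1; fixing the six binary variables makes every product linear. *)
case: (alpha _ _); case: (beta _ _); case: (gamma _ _); case: (eta _ _);
  case: (delta _ _); case: (lambda _ _); lia.
Qed.

End Dictionary.

(** * The solution built from a super-stable matching *)

Definition solution_of (n1 n2 n3 : nat) (inst : spa_st n1 n2 n3)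
    (M : {set 'I_n1 * 'I_n2}) : solution inst :=
  {| xv q := val q \in M;
     alpha j := p_under inst M j;
     beta k := l_under inst M k;
     gamma j := p_full inst M j;
     eta k := l_full inst M k;
     delta r := ~~ (Mlect inst M (val r).2 \subset D_ inst (val r).1 (val r).2);
     lambda q := ~~ (Mproj M (proj q) \subset D_ inst (stud q) (plect q)) |}.

Lemma solution_of_feasible (n1 n2 n3 : nat) (inst : spa_st n1 n2 n3)
    (M : {set 'I_n1 * 'I_n2}) :
  super_stable_matching inst M -> feasible (solution_of inst M).
Proof.
case=> -[M_acc M_fun M_pcap M_lcap] M_stable.
have xvE q : xv (solution_of inst M) q = (val q \in M) by [].
split=> [|j|k|q].
- exact/(sum_studP xvE M_acc).
- by rewrite (sum_projE xvE M_acc) lez_nat.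
- by rewrite (sum_lectE xvE M_acc M_fun) lez_nat.
have := M_stable (stud q) (proj q).
rewrite /pair_constraints /plect (sum_projE xvE M_acc).
rewrite (sum_lectE xvE M_acc M_fun).
rewrite (sum_TE xvE M_acc) (sum_DE xvE M_acc M_fun) (thetaE xvE M_acc M_fun) /=.
rewrite /blocking_pair (valP q) /= (lecturer_blocksE M_acc) ?(valP q) //.
rewrite -surjective_pairing /plect /p_under /p_full /l_under /l_full.
set k := lecturer inst _; set i := stud q; set j := proj q.
(* A variable set to 1 meets its big-M constraint because assignees stay within positive capacities:
   [1 + n - c <= 1 <= c] when [n <= c]. *)
have := M_pcap j; have := M_lcap k.
have := pcap_gt0 inst j; have := lcap_gt0 inst k.
rewrite !subset_cardI.
have := subset_leq_card (subsetIl (Mproj M j) (D_ inst i k)).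
have := subset_leq_card (subsetIl (Mlect inst M k) (D_ inst i k)).
case: (_ \notin M); case: (student_blocks _ _ _ _) => /=; lia.
Qed.

Theorem theorem4 (n1 n2 n3 : nat) (inst : spa_st n1 n2 n3) :
  (forall s : solution inst, feasible s ->
     super_stable_matching inst (matching_of s) /\
     Posz #|matching_of s| = objective s) /\
  (forall M : {set 'I_n1 * 'I_n2}, super_stable_matching inst M ->
     exists s : solution inst,
       [/\ feasible s,
           forall q : acc_pair inst, xv s q = (val q \in M)
         & objective s = Posz #|M|]).
Proof.
split=> [s [/= s_stud s_proj s_lect s_pair]|M M_stable].
  have xvE q : xv s q = (val q \in matching_of s).
    by rewrite mem_imset //; apply: val_inj.
  have M_acc i j : (i, j) \in matching_of s -> acceptable inst i j.
    by case/imsetP=> -[[i' j'] /= ij] _ [-> ->].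
  have M_fun := (sum_studP xvE M_acc).1 s_stud.
  split; last by rewrite (objectiveE xvE M_acc).
  split=> [|i j].
    split=> // [j|k].
      by rewrite -lez_nat -(sum_projE xvE M_acc).
    by rewrite -lez_nat -(sum_lectE xvE M_acc M_fun).
  (* Constraints exist only for acceptable pairs; other pairs cannot block by definition. *)
  have [ij|/negbTE ij] := boolP (acceptable inst i j); last first.
    by rewrite /blocking_pair ij.
  have := s_pair (exist _ (i, j) ij).
  exact: pair_constraints_not_blocking xvE M_acc M_fun _.
exists (solution_of inst M); split=> //; first exact: solution_of_feasible.
by case: M_stable => -[M_acc _ _ _] _; exact: objectiveE.
Qed.
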